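(* Let $\lambda$ be a nonzero cardinal, $S$ a monoid and $\theta\colon S\to H_S(1_S)$ a homomorphism. Let $(s,a_1^{-1}a_2)$ and $(t,b_1^{-1}b_2)$ be arbitrary nonzero elements of $\mathscr{P}_\lambda(\theta,S)$ (with $s,t\in S$, $a_1,a_2,b_1,b_2\in\lambda^*$). Then: (1) $(s,a_1^{-1}a_2)\,\mathscr{L}\,(t,b_1^{-1}b_2)$ in $\mathscr{P}_\lambda(\theta,S)$ if and only if $s\,\mathscr{L}\,t$ in $S$ and $a_2=b_2$; (2) $(s,a_1^{-1}a_2)\,\mathscr{R}\,(t,b_1^{-1}b_2)$ in $\mathscr{P}_\lambda(\theta,S)$ if and only if $s\,\mathscr{R}\,t$ in $S$ and $a_1=b_1$; (3) $(s,a_1^{-1}a_2)\,\mathscr{H}\,(t,b_1^{-1}b_2)$ in $\mathscr{P}_\lambda(\theta,S)$ if and only if $s\,\mathscr{H}\,t$ in $S$ and $a_1^{-1}a_2=b_1^{-1}b_2$; (4) $(s,a_1^{-1}a_2)\,\mathscr{D}\,(t,b_1^{-1}b_2)$ in $\mathscr{P}_\lambda(\theta,S)$ if and only if $s\,\mathscr{D}\,t$ in $S$.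
   Context: $\mathscr{L},\mathscr{R},\mathscr{H},\mathscr{D}$ are Green's relations: for a semigroup $T$ and $T^1$ ($T$ with identity adjoined), $a\mathscr{R}b$ iff $aT^1=bT^1$, $a\mathscr{L}b$ iff $T^1a=T^1b$, $\mathscr{H}=\mathscr{L}\cap\mathscr{R}$, $\mathscr{D}=\mathscr{L}\circ\mathscr{R}=\mathscr{R}\circ\mathscr{L}$. For a nonzero cardinal $\lambda$, $\lambda^*$ is the free monoid over the alphabet $\lambda$, $\varepsilon$ is the empty word and $|a|$ is the length of a word $a$. The $\lambda$-polycyclic monoid $P_\lambda$ is the semigroup with zero $0$ and identity $1$ generated by $\{p_i\}_{i\in\lambda}\cup\{p_i^{-1}\}_{i\in\lambda}$ subject to $p_ip_i^{-1}=1$ and $p_ip_j^{-1}=0$ for $i\ne j$ (for $\lambda=1$ it is the bicyclic monoid with adjoined zero). Identifying words of $\lambda^*$ with products of the $p_i$, each nonzero element of $P_\lambda$ is uniquely of the form $a^{-1}b$ with $a,b\in\lambda^*$. For a monoid $S$ with identity $1_S$, $H_S(1_S)$ is its group of units. Given a homomorphism $\theta\colon S\to H_S(1_S)$, put $\theta^0(s)=s$ and $\theta^n=\theta\circ\cdots\circ\theta$ ($n$ times). The Bruck–Reilly $\lambda$-polycyclic extension is the set $\mathscr{P}_\lambda(\theta,S)=(S\times(P_\lambda\setminus\{0\}))\sqcup\{\boldsymbol{0}\}$ with the associative operation $*$ for which $\boldsymbol{0}$ is a zero and $$(s,a_1^{-1}a_2)*(t,b_1^{-1}b_2)=\begin{cases}(\theta^{|u|}(s)t,(ua_1)^{-1}b_2),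 & \text{if } b_1=ua_2 \text{ for some } u\in\lambda^*,\\ (s\theta^{|v|}(t),a_1^{-1}vb_2), & \text{if } a_2=vb_1 \text{ for some } v\in\lambda^*,\\ \boldsymbol{0}, & \text{otherwise.}\end{cases}$$ *)

(* Defs.v *)
From HB Require Import structures.
From mathcomp Require Import all_boot.
From mathcomp Require Import boolp classical_sets.

Set Implicit Arguments.
Unset Strict Implicit.
Unset Printing Implicit Defensive.

Local Open Scope classical_set_scope.
Local Open Scope group_scope.

Section Green.
Variable T : semigroupType.
Implicit Types a b : T.

(* [a T^1] and [T^1 a]: the adjoined identity contributes [a] itself.  This is
   the same set whether [T^1] means [T] or [T] with a new identity when [T] is
   already a monoid. *)
Definition right_ideal a : set T := [set a] `|` [set a * x | x in [set: T]].
Definition left_ideal a : set T := [set a] `|` [set x * a | x in [set: T]].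

Definition greenR a b : Prop := right_ideal a = right_ideal b.
Definition greenL a b : Prop := left_ideal a = left_ideal b.
Definition greenH a b : Prop := greenL a b /\ greenR a b.
Definition greenD a b : Prop := exists2 c, greenL a c & greenR c b.

Lemma greenRP a b : greenR a b <->
  (a = b \/ exists x, a = b * x) /\ (b = a \/ exists x, b = a * x).
Proof.
have sub c d : (c = d \/ exists x, c = d * x) -> right_ideal c `<=` right_ideal d.
  case=> [->//|[x ->]] _ [->|[y _ <-]]; right; first by exists x.
  by exists (x * y); rewrite // mulgA.
have mem c d : right_ideal c d -> d = c \/ exists x, d = c * x.
  by case=> [->|[x _ <-]]; [left|right; exists x].
split=> [eqab|[/sub ab /sub ba]]; last by apply/seteqP.
by split; apply: mem; [rewrite -eqab|rewrite eqab]; left.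
Qed.

Lemma greenLP a b : greenL a b <->
  (a = b \/ exists x, a = x * b) /\ (b = a \/ exists x, b = x * a).
Proof.
have sub c d : (c = d \/ exists x, c = x * d) -> left_ideal c `<=` left_ideal d.
  case=> [->//|[x ->]] _ [->|[y _ <-]]; right; first by exists x.
  by exists (y * x); rewrite // mulgA.
have mem c d : left_ideal c d -> d = c \/ exists x, d = x * c.
  by case=> [->|[x _ <-]]; [left|right; exists x].
split=> [eqab|[/sub ab /sub ba]]; last by apply/seteqP.
by split; apply: mem; [rewrite -eqab|rewrite eqab]; left.
Qed.

Lemma greenD_comm a b : greenD a b <-> exists2 c, greenR a c & greenL c b.
Proof.
split=> -[c].
- move=> acL /greenRP[cb [bc|[w bw]]]; first by exists a; rewrite // bc.
  case: cb => [cb|[z cz]]; first by exists a; rewrite // -cb.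
  case/greenLP: acL => ac ca; exists (a * w).
    apply/greenRP; split; right; last by exists w.
    exists z; case: ac => [->|[x ->]]; first by rewrite -bw.
    by rewrite -!mulgA (mulgA c) -bw -cz.
  apply/greenLP; rewrite bw.
  split; [case: ac => [->|[x ->]]|case: ca => [->|[x ->]]]; try (by left);
    by right; exists x; rewrite mulgA.
- move=> acR /greenLP[cb [bc|[w bw]]]; first by exists a; rewrite // bc.
  case: cb => [cb|[z cz]]; first by exists a; rewrite // -cb.
  case/greenRP: acR => ac ca; exists (w * a).
    apply/greenLP; split; right; last by exists w.
    exists z; case: ac => [->|[x ->]]; first by rewrite -bw.
    by rewrite !mulgA -(mulgA z) -bw -cz.
  apply/greenRP; rewrite bw.
  split; [case: ac => [->|[x ->]]|case: ca => [->|[x ->]]]; try (by left);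
    by right; exists x; rewrite mulgA.
Qed.

End Green.

Section Units.
Variable S : monoidType.

Definition unit_pred : pred S := fun x => `[< exists y, x * y = 1 /\ y * x = 1 >].

(* The group of units H_S(1_S). *)
Record units := Units { unit_val :> S; _ : unit_pred unit_val }.

HB.instance Definition _ := [isSub for unit_val].
HB.instance Definition _ := [Choice of units by <:].

Fact unit_pred_closed : monoid_closed unit_pred.
Proof.
split=> [|x y /asboolP[x' [xx' x'x]] /asboolP[y' [yy' y'y]]]; apply/asboolP.
  by exists 1; rewrite mulg1.
exists (y' * x'); split.
  by rewrite mulgA -(mulgA x) yy' mulg1.
by rewrite mulgA -(mulgA y') x'x mulg1.
Qed.

HB.instance Definition _ :=
  SubChoice_isSubMonoid.Build S unit_pred units unit_pred_closed.

Fact units_inv_ex (x : units) : exists y : units, y * x = 1 /\ x * y = 1.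
Proof.
have /asboolP[y [xy yx]] := valP x.
have uy : unit_pred y by apply/asboolP; exists (val x).
by exists (Units uy); split; apply: val_inj; rewrite valM val1.
Qed.

Definition units_inv x : units := projT1 (cid (units_inv_ex x)).

HB.instance Definition _ := hasInv.Build units units_inv.

Fact units_mulVg : left_inverse 1 units_inv *%g.
Proof. by move=> x; rewrite /units_inv; case: cid => y []. Qed.

Fact units_mulgV : right_inverse 1 units_inv *%g.
Proof. by move=> x; rewrite /units_inv; case: cid => y []. Qed.

HB.instance Definition _ := Monoid_isGroup.Build units units_mulVg units_mulgV.

End Units.

Section Suffix.
Variable L : eqType.
Implicit Types a b : seq L.

(* The word [u] with [b = u ++ a], when [a] is a suffix of [b]. *)
Definition left_rest a b := take (size b - size a) b.

Lemma left_rest_cat a u : left_rest a (u ++ a) = u.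
Proof. by rewrite /left_rest size_cat addnK take_size_cat. Qed.

Variant suffix_spec a : seq L -> Prop :=
  | SuffixL u : suffix_spec a (u ++ a)
  | SuffixR v b of a = v ++ b : suffix_spec a b
  | SuffixN b of ~~ suffix a b & ~~ suffix b a : suffix_spec a b.

Lemma suffix_view a b : suffix_spec a b.
Proof.
have [/suffixP[u ->]|ab] := boolP (suffix a b); first exact: SuffixL.
have [/suffixP[v E]|ba] := boolP (suffix b a); first exact: SuffixR E.
exact: SuffixN.
Qed.

Lemma suffix_cat2r a b u : suffix (u ++ a) (b ++ a) = suffix u b.
Proof. by rewrite suffix_catl // eqxx. Qed.

Lemma suffix_total a b c : suffix a c -> suffix b c -> suffix a b || suffix b a.
Proof.
case/suffixP=> u -> /suffixP[v]; elim: u v => [|x u IH] [|y v] /=.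
- by move=> ->; rewrite suffix_refl.
- by move=> ->; rewrite -cat_cons suffix_suffix orbT.
- by move=> <-; rewrite -cat_cons suffix_suffix.
- by case=> _ /IH.
Qed.

Lemma suffixN_cat a b u : ~~ suffix a b -> ~~ suffix b a ->
  ~~ suffix (u ++ a) b /\ ~~ suffix b (u ++ a).
Proof.
move=> ab ba; split; first by apply: contra ab; apply: catl_suffix.
apply/negP=> /(suffix_total (suffix_suffix u a)).
by rewrite (negPf ab) (negPf ba).
Qed.

End Suffix.

Section Polycyclic.
Variable L : choiceType.
Implicit Types (a b u v : seq L) (i j : L).

(* The pair [(a, b)] stands for the nonzero element [a^-1 b]; by
   [polycyclic_presentation] below this is the monoid with zero presented by
   [p_i p_i^-1 = 1] and [p_i p_j^-1 = 0] for [i <> j]. *)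
Definition polycyclic_nz := (seq L * seq L)%type.
Definition frac a b : polycyclic_nz := (a, b).

(* [None] is the zero. *)
Definition polycyclic := option polycyclic_nz.
HB.instance Definition _ := Choice.on polycyclic.

Definition polycyclic_mul (x y : polycyclic) : polycyclic :=
  match x, y with
  | Some (a1, a2), Some (b1, b2) =>
      if suffix a2 b1 then Some (frac (left_rest a2 b1 ++ a1) b2)
      else if suffix b1 a2 then Some (frac a1 (left_rest b1 a2 ++ b2))
      else None
  | _, _ => None
  end.

Lemma polycyclic_mulL a1 a2 u b2 :
  polycyclic_mul (Some (a1, a2)) (Some (u ++ a2, b2)) = Some (frac (u ++ a1) b2).
Proof. by rewrite /= suffix_suffix left_rest_cat. Qed.

Lemma polycyclic_mulR a1 v b1 b2 :
  polycyclic_mul (Some (a1, v ++ b1)) (Some (b1, b2)) = Some (frac a1 (v ++ b2)).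
Proof.
rewrite /= suffix_suffix left_rest_cat; case: ifP => // /size_suffix.
case: v => [|x v]; last by rewrite /= size_cat ltnNge leq_addl.
by rewrite -[X in left_rest _ X]cat0s left_rest_cat.
Qed.

Lemma polycyclic_mulN a1 a2 b1 b2 : ~~ suffix a2 b1 -> ~~ suffix b1 a2 ->
  polycyclic_mul (Some (a1, a2)) (Some (b1, b2)) = None.
Proof. by move=> /negPf /= -> /negPf ->. Qed.

Fact polycyclic_mulA : associative polycyclic_mul.
Proof.
move=> [[a1 a2]|] [[b1 b2]|] [[c1 c2]|] //; last first.
  have mulx0 (x : polycyclic) : polycyclic_mul x None = None by case: x => [[]|].
  by rewrite !mulx0.
- case: (suffix_view b2 c1) => [u'|v' {}c1 ->|{}c1 bc cb];
    case: (suffix_view a2 b1) => [u|v {}b1 ->|{}b1 ab ba].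
  + by rewrite !polycyclic_mulL !catA polycyclic_mulL.
  + rewrite polycyclic_mulL polycyclic_mulR.
    case: (suffix_view v u') => [w|w {}u' ->|{}u' vu uv].
    * by rewrite -!catA !polycyclic_mulL.
    * by rewrite -!catA !polycyclic_mulR.
    * by rewrite !polycyclic_mulN ?suffix_cat2r.
  + have [ba' ab'] := suffixN_cat u' ba ab.
    by rewrite polycyclic_mulL !polycyclic_mulN.
  + by rewrite polycyclic_mulR !polycyclic_mulL polycyclic_mulR.
  + by rewrite !polycyclic_mulR !catA polycyclic_mulR.
  + by rewrite polycyclic_mulR !polycyclic_mulN.
  + by rewrite polycyclic_mulL !polycyclic_mulN.
  + have [bc' cb'] := suffixN_cat v bc cb.
    by rewrite polycyclic_mulR !polycyclic_mulN.
  + by rewrite !polycyclic_mulN.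
Qed.

Fact polycyclic_mul1 : left_id (Some (frac [::] [::])) polycyclic_mul.
Proof.
case=> // -[a b]; rewrite -{1}[a]cats0.
by rewrite (polycyclic_mulL [::] [::]) cats0.
Qed.

Fact polycyclic_mulx1 : right_id (Some (frac [::] [::])) polycyclic_mul.
Proof.
case=> // -[a b]; rewrite -{1}[b]cats0.
by rewrite (polycyclic_mulR a b [::]) cats0.
Qed.

HB.instance Definition _ := isMonoid.Build polycyclic
  polycyclic_mulA polycyclic_mul1 polycyclic_mulx1.

Definition pgen i : polycyclic := Some (frac [::] [:: i]).
Definition pgenV i : polycyclic := Some (frac [:: i] [::]).

Lemma frac_prod a b : Some (frac a b) =
  \prod_(i <- rev a) pgenV i * \prod_(i <- b) pgen i :> polycyclic.
Proof.
have -> : \prod_(i <- b) pgen i = Some (frac [::] b) :> polycyclic.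
  elim: b => [|x b IH]; first by rewrite big_nil.
  by rewrite big_cons IH; apply: (polycyclic_mulR [::] [:: x] [::] b).
have -> : \prod_(i <- rev a) pgenV i = Some (frac a [::]) :> polycyclic.
  elim: a => [|x a IH]; first by rewrite big_nil.
  rewrite rev_cons -cats1 big_cat big_seq1 /= IH.
  exact: (polycyclic_mulL a [::] [:: x] [::]).
by symmetry; apply: (polycyclic_mulR a [::] [::] b).
Qed.

Theorem polycyclic_presentation :
  [/\ forall i, pgen i * pgenV i = 1,
      forall i j, i <> j -> pgen i * pgenV j = None
    & forall (M : monoidType) (z : M) (p q : L -> M),
        (forall x, z * x = z /\ x * z = z) ->
        (forall i, p i * q i = 1) -> (forall i j, i <> j -> p i * q j = z) ->
        exists! f : polycyclic -> M,
          [/\ f None = z, monoid_morphism f,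
              forall i, f (pgen i) = p i & forall i, f (pgenV i) = q i]].
Proof.
split=> [i|i j ij|M z p q z0 pq pqz].
- exact: (polycyclic_mulL [::] [:: i] [::] [::]).
- apply: (polycyclic_mulN [::] [::]); rewrite -[[:: i]]/(rcons [::] i).
    by rewrite -[[:: j]]/(rcons [::] j) suffix_rcons; case: eqP ij.
  by rewrite -[[:: j]]/(rcons [::] j) suffix_rcons; case: eqP ij => // ->.
pose P a := \prod_(i <- a) p i; pose Q a := \prod_(i <- rev a) q i.
have P_cat a b : P (a ++ b) = P a * P b by exact: big_cat.
have Q_cat a b : Q (a ++ b) = Q b * Q a by rewrite /Q rev_cat; exact: big_cat.
have PQ a : P a * Q a = 1.
  elim/last_ind: a => [|a x IH]; first by rewrite /P /Q !big_nil mulg1.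
  rewrite -cats1 P_cat Q_cat mulgA -(mulgA (P a)).
  by rewrite /P /Q !big_seq1 pq mulg1.
have PQz a b : ~~ suffix a b -> ~~ suffix b a -> P a * Q b = z.
  elim/last_ind: a b => [|a x IH]; first by move=> b; rewrite suffix0s.
  elim/last_ind => [|b y _]; first by rewrite suffix0s.
  rewrite !suffix_rcons -!cats1 P_cat Q_cat mulgA -(mulgA (P a)).
  have -> : P [:: x] * Q [:: y] = p x * q y by rewrite /P /Q !big_seq1.
  have [<-|xy] := eqVneq x y; first by rewrite pq mulg1; apply: IH.
  by move=> _ _; rewrite pqz; [rewrite (z0 _).2 (z0 _).1|apply/eqP].
pose f (x : polycyclic) := if x is Some (a, b) then Q a * P b else z.
exists f; split=> [|g [g0 [g1 gM] gp gq]].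
  split=> //=; first (split; first by rewrite /f /= /P /Q !big_nil mulg1).
  - move=> [[a1 a2]|] [[b1 b2]|]; rewrite /= ?(z0 _).1 ?(z0 _).2 //.
    rewrite -[X in f X]/(polycyclic_mul (Some (a1, a2)) (Some (b1, b2))).
    case: (suffix_view a2 b1) => [u|v {}b1 ->|{}b1 ab ba].
    + rewrite (polycyclic_mulL a1 a2) /= !Q_cat !mulgA; congr (_ * _).
      by rewrite -(mulgA _ _ (Q a2)) PQ mulg1.
    + rewrite (polycyclic_mulR a1 v b1) /= !P_cat !mulgA; congr (_ * _).
      by rewrite -(mulgA _ _ (Q b1)) PQ mulg1.
    + rewrite (@polycyclic_mulN a1 a2 _ b2 ab ba) /=.
      by rewrite mulgA -(mulgA (Q a1)) PQz // (z0 _).2 (z0 _).1.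
  - by move=> i; rewrite /P /Q big_nil big_seq1 mul1g.
  - by move=> i; rewrite /P /Q big_nil big_seq1 mulg1.
apply: funext => -[[a b]|]; last by rewrite g0.
suff -> : g (Some (frac a b)) = Q a * P b by [].
rewrite frac_prod gM !(big_morph g gM g1) /P /Q.
by congr (_ * _); apply: eq_bigr.
Qed.

End Polycyclic.

Section BruckReilly.
Variables (L : choiceType) (S : monoidType).

(* The carrier does not depend on [theta], but the operation does; [None] is
   the zero. *)
Definition bruck_reilly (theta : {multiplicative S -> units S}) :=
  option (S * polycyclic_nz L).

Variable theta : {multiplicative S -> units S}.

HB.instance Definition _ := Choice.on (bruck_reilly theta).

Definition theta_iter n (s : S) : S := iter n (fun x => theta x : S) s.

Definition br_elt (s : S) (x : polycyclic_nz L) : bruck_reilly theta :=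
  Some (s, x).

(* Both suffix tests succeed only when [a2 = b1]; then [u] and [v] are empty and
   the two formulas agree, see [br_mulL], [br_mulR]. *)
Definition br_mul (x y : bruck_reilly theta) : bruck_reilly theta :=
  match x, y with
  | Some (s, (a1, a2)), Some (t, (b1, b2)) =>
      if suffix a2 b1 then
        let u := left_rest a2 b1 in
        br_elt (theta_iter (size u) s * t) (frac (u ++ a1) b2)
      else if suffix b1 a2 then
        let v := left_rest b1 a2 in
        br_elt (s * theta_iter (size v) t) (frac a1 (v ++ b2))
      else None
  | _, _ => None
  end.

Lemma theta_iterM n : {morph theta_iter n : s t / s * t}.
Proof. by elim: n => [|n IH] s t //=; rewrite IH gmulfM. Qed.

Lemma theta_iterD m n s : theta_iter (m + n) s = theta_iter m (theta_iter n s).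
Proof. exact: iterD. Qed.

Lemma br_mulL s a1 a2 t u b2 :
  br_mul (br_elt s (frac a1 a2)) (br_elt t (frac (u ++ a2) b2)) =
  br_elt (theta_iter (size u) s * t) (frac (u ++ a1) b2).
Proof. by rewrite /= suffix_suffix left_rest_cat. Qed.

Lemma br_mulR s a1 v t b1 b2 :
  br_mul (br_elt s (frac a1 (v ++ b1))) (br_elt t (frac b1 b2)) =
  br_elt (s * theta_iter (size v) t) (frac a1 (v ++ b2)).
Proof.
rewrite /= suffix_suffix left_rest_cat; case: ifP => // /size_suffix.
case: v => [|x v]; last by rewrite /= size_cat ltnNge leq_addl.
by rewrite -[X in left_rest _ X]cat0s left_rest_cat.
Qed.

Lemma br_mulN s a1 a2 t b1 b2 : ~~ suffix a2 b1 -> ~~ suffix b1 a2 ->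
  br_mul (br_elt s (frac a1 a2)) (br_elt t (frac b1 b2)) = None.
Proof. by move=> /negPf /= -> /negPf ->. Qed.

Fact br_mulA : associative br_mul.
Proof.
move=> [[s [a1 a2]]|] [[t [b1 b2]]|] [[r [c1 c2]]|] //; last first.
  have mulx0 (x : bruck_reilly theta) : br_mul x None = None.
    by case: x => [[? []]|].
  by rewrite !mulx0.
rewrite -!/(frac _ _) -!/(br_elt _ _).
case: (suffix_view b2 c1) => [u'|v' {}c1 ->|{}c1 bc cb];
  case: (suffix_view a2 b1) => [u|v {}b1 ->|{}b1 ab ba].
- rewrite !br_mulL !catA br_mulL.
  by rewrite size_cat theta_iterD theta_iterM mulgA.
- rewrite br_mulL br_mulR.
  case: (suffix_view v u') => [w|w {}u' ->|{}u' vu uv].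
  + rewrite -!catA !br_mulL !theta_iterM -theta_iterD size_cat.
    by rewrite mulgA.
  + rewrite -!catA !br_mulR !theta_iterM -theta_iterD size_cat.
    by rewrite mulgA.
  + by rewrite !br_mulN ?suffix_cat2r.
- have [ba' ab'] := suffixN_cat u' ba ab.
  by rewrite br_mulL !br_mulN.
- by rewrite br_mulR !br_mulL br_mulR mulgA.
- rewrite !br_mulR !catA br_mulR.
  by rewrite size_cat theta_iterD theta_iterM mulgA.
- by rewrite br_mulR !br_mulN.
- by rewrite br_mulL !br_mulN.
- have [bc' cb'] := suffixN_cat v bc cb.
  by rewrite br_mulR !br_mulN.
- by rewrite !br_mulN.
Qed.

HB.instance Definition _ := isSemigroup.Build (bruck_reilly theta) br_mulA.

End BruckReilly.

(* Main.v *)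
(** If [x = z * y] for nonzero [x] and [y], then the right-hand word of [y] is a
    suffix of that of [x], with no twist by [theta] on the [S]-component of [y]
    as soon as the two words have the same length.  Mutual divisibility on the
    left therefore forces equal right-hand words and mutual divisibility in [S];
    conversely a witness [r] in [S] lifts to [(r, a1^-1 b1)], which multiplies
    without twist.  The case of [R] is dual.  For [D], the intermediate element
    [(r, b1^-1 a2)] works as soon as [s L r R t]. *)
Require Import Defs.
From mathcomp Require Import all_boot.

Set Implicit Arguments.
Unset Strict Implicit.
Unset Printing Implicit Defensive.

Local Open Scope group_scope.

(** Substituting one equation into the other and comparing lengths leaves [|u| + |v| = 0]. *)
Lemma cat_antisym (T : Type) (a b u v : seq T) :
  a = u ++ b -> b = v ++ a -> u = [::] /\ v = [::].
Proof.
move=> -> /(congr1 size)/eqP.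
rewrite !size_cat addnA -[X in X == _]add0n eqn_add2r eq_sym addn_eq0.
by case/andP=> /nilP-> /nilP->.
Qed.

Section MonoidGreen.
Variable S : monoidType.
Implicit Types s t : S.

Lemma greenL_monoid s t :
  greenL s t <-> (exists r, s = r * t) /\ (exists r, t = r * s).
Proof.
split=> [/greenLP[st ts]|[st ts]]; last by apply/greenLP; split; right.
by split; [case: st|case: ts] => // ->; exists 1; rewrite mul1g.
Qed.

Lemma greenR_monoid s t :
  greenR s t <-> (exists r, s = t * r) /\ (exists r, t = s * r).
Proof.
split=> [/greenRP[st ts]|[st ts]]; last by apply/greenRP; split; right.
by split; [case: st|case: ts] => // ->; exists 1; rewrite mulg1.
Qed.

End MonoidGreen.

Section BruckReillyGreen.
Variables (L : choiceType) (S : monoidType).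
Variable theta : {multiplicative S -> units S}.
Implicit Types (s t r : S) (a b c u v : seq L) (x y z : bruck_reilly L theta).

Lemma br_mul_elt x y : x * y = br_mul x y.
Proof. by []. Qed.

Lemma br_mul0 x : x * (None : bruck_reilly L theta) = None.
Proof. by case: x => [[? []]|]. Qed.

(** The two inner words agree, so the leftover word is empty and [theta] is applied zero times. *)
Lemma br_mul_diag s t a b c :
  (br_elt theta s (frac a b) : bruck_reilly L theta) * br_elt theta t (frac b c)
  = br_elt theta (s * t) (frac a c).
Proof. exact: (br_mulL theta s a b t [::] c). Qed.

(** The hypothesis is one half of [greenLP]. Divisibility in [S] is claimed only for empty [v],
    since otherwise the product may contain [theta_iter (size v) t] in place of [t]. *)
Lemma br_left_divisor s t a1 a2 b1 b2 :
  br_elt theta s (frac a1 a2) = br_elt theta t (frac b1 b2) \/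
    (exists z : bruck_reilly L theta, br_elt theta s (frac a1 a2) =
       z * br_elt theta t (frac b1 b2)) ->
  exists2 v, a2 = v ++ b2 & v = [::] -> exists r, s = r * t.
Proof.
case=> [[-> _ ->]|]; first by exists [::] => // _; exists 1; rewrite mul1g.
case=> -[[r [c1 c2]]|] //; rewrite -/(frac c1 c2) -/(br_elt theta _ _).
rewrite br_mul_elt; case: (suffix_view c2 b1) => [u|v {}b1 ->|{}b1 cb bc].
(* Here the twist falls on [r], so the witness is [theta_iter (size u) r]. *)
- by rewrite br_mulL => -[-> _ ->]; exists [::] => // _; eexists.
- rewrite br_mulR => -[-> _ ->]; exists v => // ->.
  by exists r.
- by rewrite br_mulN.
Qed.

Lemma br_right_divisor s t a1 a2 b1 b2 :
  br_elt theta s (frac a1 a2) = br_elt theta t (frac b1 b2) \/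
    (exists z : bruck_reilly L theta, br_elt theta s (frac a1 a2) =
       (br_elt theta t (frac b1 b2) : bruck_reilly L theta) * z) ->
  exists2 u, a1 = u ++ b1 & u = [::] -> exists r, s = t * r.
Proof.
case=> [[-> -> _]|]; first by exists [::] => // _; exists 1; rewrite mulg1.
case=> -[[r [c1 c2]]|]; last by rewrite br_mul0.
rewrite -/(frac c1 c2) -/(br_elt theta _ _) br_mul_elt.
case: (suffix_view b2 c1) => [u|v {}c1 ->|{}c1 bc cb].
- rewrite br_mulL => -[-> -> _]; exists u => // ->.
  by exists r.
(* Again only the multiplier is twisted: the witness is [theta_iter (size v) r]. *)
- by rewrite br_mulR => -[-> -> _]; exists [::] => // _; eexists.
- by rewrite br_mulN.
Qed.

Lemma br_greenL s t a1 a2 b1 b2 :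
  greenL (br_elt theta s (frac a1 a2)) (br_elt theta t (frac b1 b2)) <->
  greenL s t /\ a2 = b2.
Proof.
split=> [/greenLP[/br_left_divisor[u au st] /br_left_divisor[v bv ts]]|].
  have [u0 v0] := cat_antisym au bv.
  by split; [apply/greenL_monoid; split; [apply: st|apply: ts]|rewrite au u0].
case=> /greenL_monoid[[r sr] [q tq]] <-; apply/greenLP; split; right.
  by exists (br_elt theta r (frac a1 b1)); rewrite br_mul_diag -sr.
by exists (br_elt theta q (frac b1 a1)); rewrite br_mul_diag -tq.
Qed.

Lemma br_greenR s t a1 a2 b1 b2 :
  greenR (br_elt theta s (frac a1 a2)) (br_elt theta t (frac b1 b2)) <->
  greenR s t /\ a1 = b1.
Proof.
split=> [/greenRP[/br_right_divisor[u au st] /br_right_divisor[v bv ts]]|].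
  have [u0 v0] := cat_antisym au bv.
  by split; [apply/greenR_monoid; split; [apply: st|apply: ts]|rewrite au u0].
case=> /greenR_monoid[[r sr] [q tq]] <-; apply/greenRP; split; right.
  by exists (br_elt theta r (frac b2 a2)); rewrite br_mul_diag -sr.
by exists (br_elt theta q (frac a2 b2)); rewrite br_mul_diag -tq.
Qed.

Lemma br_greenH s t a1 a2 b1 b2 :
  greenH (br_elt theta s (frac a1 a2)) (br_elt theta t (frac b1 b2)) <->
  greenH s t /\ frac a1 a2 = frac b1 b2.
Proof.
split=> [[/br_greenL[st ->] /br_greenR[st' ->]]|]; first by [].
by case=> -[stL stR] [-> ->]; split; [apply/br_greenL|apply/br_greenR].
Qed.

(** Left multiples of zero are zero; this excludes zero as the intermediate element of a [greenD]
    pair. *)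
Lemma br_greenL0 s a1 a2 : ~ greenL (br_elt theta s (frac a1 a2)) None.
Proof. by case/greenLP=> -[//|[z]]; rewrite br_mul0. Qed.

Lemma br_greenD s t a1 a2 b1 b2 :
  greenD (br_elt theta s (frac a1 a2)) (br_elt theta t (frac b1 b2)) <->
  greenD s t.
Proof.
split=> [[[[r [c1 c2]]|]]|[r sr rt]]; last 1 first.
(* Both words are forced: [greenL] with the first element fixes [a2], [greenR] with the second fixes
   [b1]. *)
- by exists (br_elt theta r (frac b1 a2)); [apply/br_greenL|apply/br_greenR].
- by move=> /br_greenL[sr _] /br_greenR[rt _]; exists r.
- by move=> /br_greenL0.
Qed.

End BruckReillyGreen.

Theorem mainTheorem3 (lambda : choiceType) (lambda_nonempty : inhabited lambda)
    (S : monoidType) (theta : {multiplicative S -> units S})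
    (s t : S) (a1 a2 b1 b2 : seq lambda) :
  let x : bruck_reilly lambda theta := br_elt theta s (frac a1 a2) in
  let y : bruck_reilly lambda theta := br_elt theta t (frac b1 b2) in
  (greenL x y <-> greenL s t /\ a2 = b2) /\
  (greenR x y <-> greenR s t /\ a1 = b1) /\
  (greenH x y <-> greenH s t /\ frac a1 a2 = frac b1 b2) /\
  (greenD x y <-> greenD s t).
Proof.
move=> x y; split; first exact: br_greenL.
split; first exact: br_greenR.
by split; [exact: br_greenH|exact: br_greenD].
Qed.
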